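(* Let $A,B\in\mathbb{R}^{2\times2}$ with $\det(B)=0$, and let $C=\det(A+B)-\det(A)-\det(B)$. Assume that $C$, $\operatorname{Tr}(B)$ and $\det(B)$ do not vanish simultaneously. Then the delay-differential equation $\dot x(t)=Ax(t)+Bx(t-\tau)$ is of universality class III if and only if $$|\det(A)|=|C|,\qquad (\operatorname{Tr}(A))^2-(\operatorname{Tr}(B))^2<2\det(A).$$
   Context: Generating polynomial: $p_\omega(Y)=\det[i\omega I-A-BY]$. Asymptotic continuous spectrum (ACS): the collection of curves $\left\{\frac1\tau\gamma_j(\omega)+i\omega\right\}$, $\omega\in\mathbb{R}$, $j=1,\dots,m$, where $\gamma_j(\omega)=-\ln|Y_j(\omega)|$ and $Y_j(\omega)$ are the roots of the generating polynomial, $p_\omega(Y_j(\omega))=0$. Points $\omega$ for which the polynomial is degenerate, i.e. $p_\omega(Y)\equiv\det[i\omega I-A]$ for all $Y$, are excluded. A branch of the ACS is one of the functions $\gamma_j$. Universality class III: the ACS (and the DDE) is of universality class III if there exist $\omega_H>0$ and $j\in\mathbb{N}$ such that a branch of the ACS satisfies $\gamma_j(0)=0$ and $\gamma_j(\pm\omega_H)=0$, $\gamma_j(\omega)>0$ for all $\omega\in(-\omega_H,0)\cup(0,\omega_H)$, and $\gamma_j(\omega)<0$ for all $\omega\notin[-\omega_H,\omega_H]$; moreover, $\gamma_k(\omega)\neq0$ for all $k\neq j$ and $\omega\in\mathbb{R}$.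
   Formalization: When C=0 the point ω=0 is degenerate and excluded, and the class III requirement γ_j(0)=0 is dropped there; class III conditions are imposed only at non-degenerate ω (with γ_j(0)=0 required, A=0, B=diag(1,0) is a counterexample). *)

(* Defs.v *)
From mathcomp Require Import all_boot all_order all_algebra.
From mathcomp Require Import all_classical all_reals all_analysis.
From mathcomp Require Import complex.

Set Implicit Arguments.
Unset Strict Implicit.
Unset Printing Implicit Defensive.

Import Order.TTheory GRing.Theory Num.Theory.
Import numFieldNormedType.Exports.

Local Open Scope classical_set_scope.
Local Open Scope ring_scope.
Local Open Scope complex_scope.

(* The delay-differential equation x'(t) = A x(t) + B x(t - tau) in R^n.
   None of the notions below depends on tau: it only rescales the real part of
   the curves gamma_j(w) / tau + i w, whereas the universality class is defined
   through the functions gamma_j. *)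
Record dde (R : realType) (n : nat) := DDE {
  dde_A : 'M[R]_n;
  dde_B : 'M[R]_n;
  dde_tau : R
}.

Section ACS.
Context {R : realType} {n : nat}.
Variable S : dde R n.

(* i w I - A *)
Definition instantaneous_mx (w : R) : 'M[R[i]]_n :=
  (0 +i* w)%:M - map_mx (real_complex R) (dde_A S).

Definition genpoly (w : R) : {poly R[i]} :=
  \det (map_mx polyC (instantaneous_mx w)
        - 'X *: map_mx polyC (map_mx (real_complex R) (dde_B S))).

Definition degenerate (w : R) : Prop :=
  genpoly w = (\det (instantaneous_mx w))%:P.

(* The frequencies over which the asymptotic continuous spectrum is defined:
   degenerate points are excluded. *)
Definition acs_dom : set R := [set w | ~ degenerate w].

(* The degree of genpoly w in Y can drop at isolated w, some roots then going to
   infinity; None stands for such a root at infinity. *)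
Definition root_modulus (y : option R[i]) : \bar R :=
  if y is Some z then (Normc.normc z)%:E else +oo%E.

(* - ln |Y_j(w)|, which is +oo where Y_j(w) = 0 and -oo for a root at
   infinity. *)
Definition acs_gamma {m : nat} (Y : 'I_m -> R -> option R[i])
    (j : 'I_m) (w : R) : \bar R :=
  (- lne (root_modulus (Y j w)))%E.

(* Y_1, ..., Y_m enumerate the roots of the generating polynomial with
   multiplicities, m being its generic degree in Y, in such a way that each
   gamma_j is a curve. *)
Definition acs_branches (m : nat) (Y : 'I_m -> R -> option R[i]) : Prop :=
  [/\ exists w, size (genpoly w) = m.+1,
      forall w, acs_dom w ->
        genpoly w = lead_coef (genpoly w) *:
          \prod_(j < m) (if Y j w is Some y then 'X - y%:P else 1)
    & forall j, {within acs_dom, continuous (acs_gamma Y j)}].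

(* Since degenerate points are excluded from the asymptotic continuous spectrum,
   each requirement on a branch bears on the points of acs_dom only; when 0 is
   degenerate, gamma_j(0) does not exist and nothing is required at 0. *)
Definition universality_class_III : Prop :=
  exists (m : nat) (Y : 'I_m -> R -> option R[i]), acs_branches Y /\
  exists (wH : R) (j : 'I_m), 0 < wH /\
    forall w, acs_dom w ->
      [/\ w = 0 \/ w = wH \/ w = - wH -> acs_gamma Y j w = 0%E,
          - wH < w < 0 \/ 0 < w < wH -> (0 < acs_gamma Y j w)%E,
          ~ (- wH <= w <= wH) -> (acs_gamma Y j w < 0)%E
        & forall k, k <> j -> acs_gamma Y k w <> 0%E].

End ACS.

(* Main.v *)
(** Since det B = 0, the generating polynomial has degree at most one in Y, so
    the only branch is gamma(w) = - ln |Y(w)| with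
    Y(w) = (w^2 - det A + i w tr A) / (C - i w tr B).
    Comparing squared moduli, gamma(w) has the sign opposite to that of
    w^4 + ((tr A)^2 - (tr B)^2 - 2 det A) w^2 + (det A)^2 - C^2,
    and this biquadratic has the sign pattern of class III exactly when its
    constant term is zero and its middle coefficient is negative. When C = 0 the
    point w = 0 is degenerate, and the constant term, being the square
    (det A)^2, is forced to vanish by the negativity on (0, wH). *)
Require Import Defs.
From mathcomp Require Import all_boot all_order all_algebra.
From mathcomp Require Import all_classical all_reals all_analysis.
From mathcomp Require Import complex.
From mathcomp Require Import ring lra.

Import Order.TTheory GRing.Theory Num.Theory.
Import numFieldNormedType.Exports.

Local Open Scope ring_scope.
Local Open Scope complex_scope.

(** * Two-by-two matrices and the extended logarithm *)

Lemma det_mx2 (K : comNzRingType) (M : 'M[K]_2) :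
  \det M = M 0 0 * M 1 1 - M 0 1 * M 1 0.
Proof.
rewrite (expand_det_row _ 0) !big_ord_recl big_ord0 addr0 /cofactor !det_mx11.
rewrite !mxE /= expr0 mul1r expr1 mulN1r mulrN.
by congr (_ * M _ _ - M _ _ * M _ _); apply/val_inj.
Qed.

Lemma tr_mx2 (K : pzRingType) (M : 'M[K]_2) : \tr M = M 0 0 + M 1 1.
Proof.
rewrite /mxtrace !big_ord_recl big_ord0 addr0.
by congr (_ + M _ _); apply/val_inj.
Qed.

(** Since [lne] is constantly -oo on nonpositive reals, continuity there is divergence to -oo,
    secured by [y < expR r]. This makes the branch continuous, with value +oo, at zeros of the
    root. *)
Lemma continuous_lne_EFin (R : realType) :
  continuous (fun x : R => lne x%:E).
Proof.
move=> x; have [x0|x0] := leP x 0.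
  rewrite /continuous_at le0_lneNy ?lee_fin//; apply/cvgeNyPle => r.
  near=> y.
  have [y0|y0] := leP y 0; first by rewrite le0_lneNy ?lee_fin ?leNye.
  rewrite lne_EFin// lee_fin -ler_expR lnK ?posrE// ltW//.
  near: y; apply: lt_nbhsl; exact: le_lt_trans x0 (expR_gt0 r).
rewrite /continuous_at lne_EFin//.
have lnx : ((ln y)%:E @[y --> x] --> (ln x)%:E)%classic.
  by apply: cvg_EFin; [exact: nearW|exact: continuous_ln].
apply: cvg_trans lnx; apply: near_eq_cvg; near=> y; rewrite lne_EFin//.
by near: y; exact: lt_nbhsr.
Unshelve. all: by end_near. Qed.

(** * The generating polynomial when det B = 0 *)

Section planar_genpoly.
Context {R : realType}.
Variables (A B : 'M[R]_2) (tau : R).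
Hypothesis detB0 : \det B = 0.

Let C := \det (A + B) - \det A - \det B.
Let S := DDE A B tau.

Definition root_num (w : R) : R[i] := (w ^+ 2 - \det A) +i* (w * \tr A).

Definition root_den (w : R) : R[i] := C +i* - (w * \tr B).

Lemma det_instantaneous_mx w : \det (instantaneous_mx S w) = - root_num w.
Proof.
rewrite det_mx2 /root_num det_mx2 tr_mx2 /instantaneous_mx !mxE/=.
by apply/eqP; rewrite eq_complex/=; apply/andP; split; apply/eqP;
  rewrite ?mulr1n ?mulr0n; ring.
Qed.

Lemma genpolyE w : genpoly S w = root_den w *: 'X - (root_num w)%:P.
Proof.
set I := instantaneous_mx S w.
have dE : root_den w = - (I 0 0 * (B 1 1)%:C + I 1 1 * (B 0 0)%:C
                          - I 0 1 * (B 1 0)%:C - I 1 0 * (B 0 1)%:C).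
  rewrite /root_den /C !det_mx2 tr_mx2 /I /instantaneous_mx !mxE/=.
  by apply/eqP; rewrite eq_complex/=; apply/andP; split; apply/eqP;
    rewrite ?mulr1n ?mulr0n; ring.
have B0 : (B 0 0)%:C * (B 1 1)%:C - (B 0 1)%:C * (B 1 0)%:C = 0.
  by rewrite -!rmorphM -rmorphB -det_mx2 detB0.
rewrite -polyCN -det_instantaneous_mx dE -/I /genpoly -/I !det_mx2 !mxE/=.
rewrite -mul_polyC.
have := congr1 polyC B0.
rewrite !(polyCN, polyCB, polyCD, polyCM) polyC0.
rewrite mulr1n.
(* With the entries abstracted, this is a commutative ring identity modulo [b00 * b11 = b01 * b10],
   the relation that kills the quadratic term. *)
move: (_ *i)%:P (A 0 0)%:C%:P (A 0 1)%:C%:P (A 1 0)%:C%:P (A 1 1)%:C%:P.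
move: (B 0 0)%:C%:P (B 0 1)%:C%:P (B 1 0)%:C%:P (B 1 1)%:C%:P.
move: 'X => x b00 b01 b10 b11 iw a00 a01 a10 a11 /subr0_eq E.
ring: E.
Qed.

Lemma degenerateP w : degenerate S w <-> root_den w = 0.
Proof.
rewrite /degenerate genpolyE det_instantaneous_mx polyCN; split => [E|->].
  by have /(congr1 (fun p : {poly _} => p`_1)) := E;
    rewrite coefB coefN coefZ coefX !coefC/= mulr1 oppr0 addr0.
by rewrite scale0r sub0r.
Qed.

Lemma acs_domP w : acs_dom S w <-> root_den w != 0.
Proof.
split; first by move=> nd; apply/eqP => /degenerateP.
by move=> /eqP nd /degenerateP.
Qed.

Lemma size_genpoly w : root_den w != 0 -> size (genpoly S w) = 2.
Proof.
move=> den0; rewrite genpolyE size_polyDl size_scale ?size_polyX//.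
by rewrite size_polyN (leq_ltn_trans (size_polyC_leq1 _)).
Qed.

Lemma size_genpoly_le2 w : (size (genpoly S w) <= 2)%N.
Proof.
rewrite genpolyE (leq_trans (size_polyD _ _))// geq_max.
rewrite (leq_trans (size_scale_leq _ _)) ?size_polyX//=.
by rewrite size_polyN (leq_trans (size_polyC_leq1 _)).
Qed.

(** * The single branch of the spectrum and its sign *)

Definition planar_gamma (w : R) : \bar R :=
  (- lne (Normc.normc (root_num w) / Normc.normc (root_den w))%R%:E)%E.

Lemma acs_gamma_ratio (w : R) :
  (- lne (root_modulus (Some (root_num w / root_den w)%R)))%E = planar_gamma w.
Proof. by rewrite /root_modulus Normc.normcM Normc.normcV. Qed.

(** The degree bound gives [m <= 1], and the index [j] excludes [m = 0]. *)
Lemma acs_branches_size m (Y : 'I_m -> R -> option R[i]) (j : 'I_m) :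
  acs_branches S Y -> m = 1.
Proof.
move=> [[w sz] _ _]; have := size_genpoly_le2 w; rewrite sz.
by case: m {Y sz} j => [[]//|[|m]] _.
Qed.

(** Off degenerate points the degree is exactly one: a root at infinity would leave a constant
    polynomial, and a finite root must be [root_num w / root_den w]. Hence every admissible
    enumeration yields the same curve. *)
Lemma acs_branches_gamma (Y : 'I_1 -> R -> option R[i]) (j : 'I_1) (w : R) :
  acs_branches S Y -> acs_dom S w -> acs_gamma Y j w = planar_gamma w.
Proof.
move=> [_ prodY _] domw; have /acs_domP den0 := domw.
have := prodY _ domw; have := size_genpoly _ den0.
rewrite big_ord1 (ord1 j) /acs_gamma.
case: (Y 0 w) => [y _|/[swap] ->]; last first.
  by rewrite alg_polyC => /eqP; rewrite ltn_eqF//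
    (leq_ltn_trans (size_polyC_leq1 _)).
move=> /(congr1 (fun p => p.[y])); rewrite hornerZ hornerXsubC subrr mulr0.
rewrite genpolyE hornerD hornerN hornerZ hornerX hornerC => /eqP.
rewrite subr_eq0 mulrC => /eqP numE.
by rewrite -acs_gamma_ratio -numE mulfK.
Qed.

Lemma planar_gamma_continuous w :
  root_den w != 0 -> {for w, continuous planar_gamma}.
Proof.
move=> den0; apply: cvgeN.
apply: (@continuous_comp _ _ _
  (fun w => Normc.normc (root_num w) / Normc.normc (root_den w))
  (fun x => lne x%:E)); last exact: continuous_lne_EFin.
have sqr_cont (f : R -> R) : continuous f -> continuous (fun v => f v ^+ 2).
  move=> fc v; apply: (@continuous_comp _ _ _ f (fun x => x ^+ 2)).
    exact: fc.
  exact: exprn_continuous.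
have normc_cont (f g : R -> R) : continuous f -> continuous g ->
    continuous (fun v => Normc.normc (f v +i* g v)).
  move=> fc gc v; rewrite /Normc.normc.
  apply: (@continuous_comp _ _ _ (fun v => f v ^+ 2 + g v ^+ 2) Num.sqrt);
    last exact: sqrt_continuous.
  by apply: cvgD; exact: sqr_cont.
have lin_cont (a : R) : continuous (fun v : R => v * a).
  by move=> v; apply: cvgMl; exact: cvg_id.
apply: cvgM; last apply: cvgV.
- apply: (normc_cont (fun v => v ^+ 2 - \det A) (fun v => v * \tr A)) => // v.
  by apply: cvgB; [exact: exprn_continuous|exact: cvg_cst].
- by apply: contra den0 => /eqP/Normc.eq0_normc ->.
- apply: (normc_cont (fun=> C) (fun v => - (v * \tr B))) => v.
    exact: cvg_cst.
  by apply: cvgN; exact: lin_cont.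
Qed.

(** This is the squared modulus of [root_num w] minus that of [root_den w]. *)
Definition char_biquad (w : R) : R :=
  w ^+ 4 + (\tr A ^+ 2 - \tr B ^+ 2 - 2 * \det A) * w ^+ 2
  + (\det A ^+ 2 - C ^+ 2).

Lemma planar_gamma_sign w : root_den w != 0 ->
  [/\ planar_gamma w = 0%E <-> char_biquad w = 0,
      (0 < planar_gamma w)%E <-> char_biquad w < 0
    & (planar_gamma w < 0)%E <-> 0 < char_biquad w].
Proof.
move=> den0.
have nden_gt0 : 0 < Normc.normc (root_den w).
  rewrite lt_def {2}/Normc.normc sqrtr_ge0 andbT.
  by apply: contra den0 => /eqP/Normc.eq0_normc ->.
have biquadE : char_biquad w = ((w ^+ 2 - \det A) ^+ 2 + (w * \tr A) ^+ 2) -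
    (C ^+ 2 + (- (w * \tr B)) ^+ 2).
  by rewrite /char_biquad; ring.
have den2_gt0 : 0 < C ^+ 2 + (- (w * \tr B)) ^+ 2.
  by rewrite -sqrtr_gt0.
have num2_ge0 : 0 <= (w ^+ 2 - \det A) ^+ 2 + (w * \tr A) ^+ 2.
  by rewrite addr_ge0 ?sqr_ge0.
split.
- suff E : (planar_gamma w == 0%E) = (char_biquad w == 0).
    by split=> /eqP; [rewrite E|rewrite -E] => /eqP.
  rewrite oppe_eq0 lne_eq0 eqe -subr_eq0 -{1}(divff (lt0r_neq0 nden_gt0))
    -mulrBl mulf_eq0 invr_eq0 (gt_eqF nden_gt0) orbF subr_eq0 biquadE subr_eq0 /Normc.normc.
  by rewrite eqr_sqrt// ltW.
- rewrite oppe_gt0 lne_lt0 lte_fin ltr_pdivrMr// mul1r.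
  by rewrite biquadE subr_lt0 /Normc.normc ltr_sqrt.
- rewrite oppe_lt0 lne_gt0 lte_fin ltr_pdivlMr// mul1r.
  (* The larger side is now the numerator, not known in advance to be positive as [ltr_sqrt]
     demands; the forward direction therefore goes by contraposition and weak monotonicity of the
     square root. *)
  rewrite biquadE subr_gt0 /Normc.normc; split => [|lt_dn].
    by apply: contraTT; rewrite -!leNgt => /ler_wsqrtr.
  by rewrite ltr_sqrt// (lt_trans den2_gt0).
Qed.

(** The clause on the other branches is vacuous with one index, so only signs along the single curve
    remain. The nondegenerate frequency witnesses generic degree one. *)
Lemma universality_class_IIIE :
  (exists w, root_den w != 0) ->
  universality_class_III S <->
  exists2 wH : R, 0 < wH & forall w, root_den w != 0 ->
    [/\ w = 0 \/ w = wH \/ w = - wH -> char_biquad w = 0,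
        - wH < w < 0 \/ 0 < w < wH -> char_biquad w < 0
      & ~ (- wH <= w <= wH) -> 0 < char_biquad w].
Proof.
move=> [w0 den0]; split.
  move=> [m [Y [brY [wH [j [wH0 hY]]]]]]; exists wH => // w denw.
  have m1 := acs_branches_size _ _ j brY; subst m.
  have domw : acs_dom S w by apply/acs_domP.
  have [h0 hpos hneg _] := hY w domw.
  have [s0 spos sneg] := planar_gamma_sign _ denw.
  move: h0 hpos hneg; rewrite (acs_branches_gamma _ _ _ brY domw).
  by move=> h0 hpos hneg; split => hw;
    [apply/s0/h0|apply/spos/hpos|apply/sneg/hneg].
move=> [wH wH0 hF].
exists 1, (fun _ w => Some (root_num w / root_den w)).
have gammaE (j : 'I_1) :
    acs_gamma (fun _ w => Some (root_num w / root_den w)) j = planar_gamma.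
  by apply/funext => w; rewrite /acs_gamma acs_gamma_ratio.
split; first split.
- by exists w0; exact: size_genpoly.
- move=> w /acs_domP denw; rewrite big_ord1 genpolyE.
  have lcE : lead_coef (root_den w *: 'X - (root_num w)%:P) = root_den w.
    rewrite lead_coefDl; first by rewrite lead_coefZ lead_coefX mulr1.
    rewrite size_polyN size_scale// size_polyX.
    by rewrite (leq_ltn_trans (size_polyC_leq1 _)).
  by rewrite lcE scalerBr scale_polyC mulrCA divff// mulr1.
- move=> j; rewrite gammaE; apply: continuous_in_subspaceT => w.
  by rewrite inE => /acs_domP; exact: planar_gamma_continuous.
exists wH, ord0; split=> // w /acs_domP denw; rewrite gammaE.
have [h0 hneg hpos] := hF w denw.
have [s0 spos sneg] := planar_gamma_sign _ denw.
split=> [/h0/s0//|/hneg/spos//|/hpos/sneg//|k].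
by rewrite (ord1 k).
Qed.

End planar_genpoly.

(** * Sign pattern of the biquadratic *)

Theorem lemma6p1 (R : realType) (A B : 'M[R]_2) (tau : R) (tau_gt0 : 0 < tau)
    (detB0 : \det B = 0) (C : R) (CE : C = \det (A + B) - \det A - \det B)
    (nonvanishing : ~ [/\ C = 0, \tr B = 0 & \det B = 0]) :
  universality_class_III (DDE A B tau) <->
  `|\det A| = `|C| /\ (\tr A) ^+ 2 - (\tr B) ^+ 2 < 2 * \det A.
Proof.
(* Only [w = 0] can be degenerate, and only if [C = 0]: at any other frequency a zero denominator
   would force both [C] and the trace of [B] to vanish. *)
have den_neq0 w : C != 0 \/ w != 0 -> root_den A B w != 0.
  rewrite /root_den -CE eq_complex/= oppr_eq0 mulf_eq0 negb_and negb_or.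
  case=> [->//|w0]; have [C0|//] := eqVneq C 0; rewrite w0/=.
  by apply/eqP => b0; apply: nonvanishing.
apply: (iff_trans (universality_class_IIIE A B tau detB0 _)).
  by exists 1; apply: den_neq0; right; exact: oner_neq0.
rewrite /char_biquad -CE.
set K := _ - _ - _; set d := \det A.
have -> : (\tr A ^+ 2 - \tr B ^+ 2 < 2 * d) = (K < 0) by rewrite subr_lt0.
split.
  move=> [h h0 hF].
  have wh : h ^+ 4 + K * h ^+ 2 + (d ^+ 2 - C ^+ 2) = 0.
    have [+ _ _] := hF h (den_neq0 _ (or_intror (lt0r_neq0 h0))).
    by apply; right; left.
  have dC : d ^+ 2 = C ^+ 2.
    (* For nonzero [C] the value at 0 is the constant term. For [C = 0] nothing is known at 0, and a
       nonzero [d] is refuted by a point of [(0, h)] where the biquadratic is nonnegative. *)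
    have [C0|C0] := eqVneq C 0; last first.
      have [+ _ _] := hF 0 (den_neq0 _ (or_introl C0)).
      move=> /(_ (or_introl erefl)); rewrite !expr0n/= mulr0 !add0r => /eqP.
      by rewrite subr_eq0 => /eqP.
    rewrite C0 expr0n/= subr0 in wh hF *.
    apply/eqP; rewrite sqrf_eq0; apply: contraT => d0.
    have dgt0 : 0 < `|d| by rewrite normr_gt0.
    (* By Vieta the second positive root is [|d| / h]; the biquadratic is
       positive at [h * s], which lies below both roots. *)
    pose s := `|d| / (`|d| + h ^+ 2).
    have D0 : 0 < `|d| + h ^+ 2 by rewrite addr_gt0// exprn_gt0.
    have s0 : 0 < s by rewrite divr_gt0.
    have s1 : s < 1 by rewrite ltr_pdivrMr// mul1r ltrDl exprn_gt0.
    have sd : s * h ^+ 2 < `|d|.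
      by rewrite mulrAC ltr_pdivrMr// ltr_pM2l// ltrDr.
    have hs0 : 0 < h * s by rewrite mulr_gt0.
    have hs1 : h * s < h by rewrite gtr_pMr.
    have [_ + _] := hF (h * s) (den_neq0 _ (or_intror (lt0r_neq0 hs0))).
    rewrite hs0 hs1 => /(_ (or_intror erefl)).
    have Kh : K * h ^+ 2 = - h ^+ 4 - d ^+ 2 by lra.
    have -> : (h * s) ^+ 4 + K * (h * s) ^+ 2 + d ^+ 2 =
        (1 - s ^+ 2) * (`|d| ^+ 2 - (s * h ^+ 2) ^+ 2).
      rewrite real_normK ?num_real//; ring: Kh.
    rewrite ltNge mulr_ge0// subr_ge0 ltW//.
      by rewrite expr_lt1// ltW.
    by rewrite ltr_pXn2r// nnegrE ltW// mulr_gt0 ?exprn_gt0.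
  split.
    by apply/eqP; rewrite -(@eqrXn2 _ 2)// !real_normK ?num_real// dC.
  (* Now [h ^+ 2 * (h ^+ 2 + K) = 0], so [K = - h ^+ 2]. *)
  move: wh; rewrite dC subrr addr0 => wh.
  have h2 : 0 < h ^+ 2 by rewrite exprn_gt0.
  by nra.
move=> [dC K0].
have -> : d ^+ 2 - C ^+ 2 = 0.
  by rewrite -[d ^+ 2]real_normK ?num_real// dC real_normK ?num_real// subrr.
(* With zero constant term the biquadratic is [w ^+ 2 * (w ^+ 2 + K)], and this is its positive
   root. *)
exists (Num.sqrt (- K)); first by rewrite sqrtr_gt0 oppr_gt0.
set h := Num.sqrt _ => w _.
have h0 : 0 < h by rewrite sqrtr_gt0 oppr_gt0.
have KE : K = - h ^+ 2 by rewrite sqr_sqrtr ?opprK// oppr_ge0 ltW.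
have FE : w ^+ 4 + K * w ^+ 2 + 0 = w ^+ 2 * ((w - h) * (w + h)).
  by rewrite KE; ring.
rewrite FE; split.
- by case=> [->|[]->]; ring.
- move=> hw; have w20 : 0 < w ^+ 2.
    by rewrite exprn_even_gt0//=; apply/eqP; case: hw => /andP[? ?]; lra.
  by rewrite pmulr_rlt0//; case: hw => /andP[? ?]; nra.
- move=> /negP; rewrite negb_and -!ltNge => hw.
  have w20 : 0 < w ^+ 2.
    by rewrite exprn_even_gt0//=; apply/eqP; case/orP: hw; lra.
  by rewrite pmulr_rgt0//; case/orP: hw => ?; nra.
Qed.
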